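(* Let $n\ge 5$. Among all polyomino chains with $n$ squares, the chains maximizing the augmented Zagreb index $AZI$ are exactly: the chain $AZ^1_{(n-1)/2}$ when $n$ is odd, and the chains of the family $AZ^2_{n/2}$ when $n$ is even. Moreover, the maximum value is $$M(n)=\frac{4456}{125}n-\frac{26763}{2000}-\frac{2312}{3375}\,I_{\{n\text{ even}\}},$$ where $I_{\{n\text{ even}\}}$ equals $1$ if $n$ is even and $0$ otherwise.
   Context: Polyomino chains (restricted model). For $n\ge 2$, a polyomino chain with $n$ squares is a sequence of closed unit squares $S_1,\dots,S_n$ in the plane with $S_1=[0,1]\times[0,1]$, $S_2=[1,2]\times[0,1]$, and for $k\ge 3$, $S_k=S_{k-1}+v_k$, where $v_2=(1,0)$ and each $v_k\in\{(1,0),(0,-1)\}$ satisfies $v_k=v_{k-1}$ if $L_k=1$ and $v_k\neq v_{k-1}$ if $L_k=2$. For $n\ge3$ the chain is determined by its link vector $(L_3,\dots,L_n)\in\{1,2\}^{n-2}$ and denoted $PC(L_3,\dots,L_n)$. Each chain is regarded as the graph whose vertices are the corners of the squares and whose edges are the sides of the squares. The augmented Zagreb index is $AZI(G)=\sum_{uv\in E(G)}\left(\frac{d_ud_v}{d_u+d_v-2}\right)^3$, where $d_u$ is the degree of $u$. Segments: a segment of a chain is a maximal run of consecutive squares $S_a,S_{a+1},\dots,S_b$ ($b>a$) lying in a common row or a common column; consecutive segments share exactly one square (a kink, where the chain changes direction), so a chain with $m$ segments of lengths (numbers of squares) $l_1,\dots,l_m$ satisfies $\sum l_i=n+m-1$.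 A segment is external if it contains $S_1$ or $S_n$, and internal otherwise. $AZ^1_m$ ($m\ge2$) denotes the polyomino chain with $m$ segments all of length 3; $AZ^2_m$ ($m\ge3$) denotes the family of polyomino chains with $m$ segments all of length 3 except exactly one internal segment of length 2. *)

(* Defs.v *)
From mathcomp Require Export all_boot all_order all_algebra.

Set Implicit Arguments.
Unset Strict Implicit.
Unset Printing Implicit Defensive.

Import Order.TTheory GRing.Theory Num.Theory.

Local Open Scope ring_scope.

Definition point : Type := (int * int)%type.

(* The closed unit square [x, x+1] * [y, y+1] is represented by its lower-left
   corner (x, y), and a chain S_1, ..., S_n by the sequence of its squares;
   S_k is thus the item of index k - 1. *)
Definition chain : Type := seq point.

Definition right : point := (1, 0).
Definition down : point := (0, -1).

Definition other_dir (v : point) : point := if v == right then down else right.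

(* [s] is the current square S_{k-1}, [v] the last displacement v_{k-1}, and
   [L] the list of the remaining links L_k, ..., L_n. *)
Fixpoint squares_from (s v : point) (L : seq nat) : chain :=
  if L is l :: L' then
    let v' := if l == 1%N then v else other_dir v in
    s :: squares_from (s.1 + v'.1, s.2 + v'.2) v' L'
  else [:: s].

Definition link_vector (n : nat) (L : seq nat) : bool :=
  ((size L).+2 == n) && all [pred l | (l == 1%N) || (l == 2)] L.

Definition PC (L : seq nat) : chain := (0, 0) :: squares_from (1, 0) right L.

Definition polyomino_chain (n : nat) (c : chain) : Prop :=
  exists2 L : seq nat, link_vector n L & c = PC L.

(* An undirected side is stored once, with its lower or left endpoint first, so
   that a side shared by two squares has a single representation. *)
Definition sides (s : point) : seq (point * point) :=
  let: (x, y) := s in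
  [:: ((x, y), (x + 1, y)); ((x, y + 1), (x + 1, y + 1));
      ((x, y), (x, y + 1)); ((x + 1, y), (x + 1, y + 1))].

(* The vertices of the graph are the corners, i.e., the endpoints of the edges. *)
Definition edges (c : chain) : seq (point * point) :=
  undup (flatten [seq sides s | s <- c]).

Definition deg (c : chain) (u : point) : nat :=
  count [pred e : point * point | (e.1 == u) || (e.2 == u)] (edges c).

(* All terms of the sum are rational, so the index takes its values in rat. *)
Definition AZI (c : chain) : rat :=
  \sum_(e <- edges c)
    (((deg c e.1)%:R * (deg c e.2)%:R)
       / ((deg c e.1)%:R + (deg c e.2)%:R - 2)) ^+ 3.

(* A run of consecutive squares is given by the pair (a, b) of the 0-based
   indices of its first and last squares. *)
Definition squares_of (c : chain) (r : nat * nat) : seq point :=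
  drop r.1 (take r.2.+1 c).

Definition aligned_run (c : chain) (r : nat * nat) : bool :=
  [&& (r.1 < r.2)%N, (r.2 < size c)%N
    & constant [seq s.1 | s <- squares_of c r]
      || constant [seq s.2 | s <- squares_of c r]].

Definition runs (c : chain) : seq (nat * nat) :=
  [seq r <- [seq (a, b) | a <- iota 0 (size c), b <- iota 0 (size c)]
     | aligned_run c r].

Definition segments (c : chain) : seq (nat * nat) :=
  [seq r <- runs c
     | all [pred r' | (r'.1 <= r.1)%N && (r.2 <= r'.2)%N ==> (r' == r)] (runs c)].

Definition seg_length (r : nat * nat) : nat := (r.2 - r.1).+1.

Definition external (c : chain) (r : nat * nat) : bool :=
  (r.1 == 0%N) || (r.2 == (size c).-1).

Definition internal (c : chain) (r : nat * nat) : bool := ~~ external c r.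

Definition AZ1 (m : nat) (c : chain) : Prop :=
  [/\ exists n, polyomino_chain n c,
      size (segments c) = m
    & forall r, r \in segments c -> seg_length r = 3].

Definition AZ2 (m : nat) (c : chain) : Prop :=
  [/\ exists n, polyomino_chain n c,
      size (segments c) = m
    & exists r, [/\ r \in segments c, internal c r, seg_length r = 2
      & forall r', r' \in segments c -> r' <> r -> seg_length r' = 3]].

Definition maximizes_AZI (n : nat) (c : chain) : Prop :=
  polyomino_chain n c /\
  forall c', polyomino_chain n c' -> AZI c' <= AZI c.

(* 4456/125 n - 26763/2000 - 2312/3375 I_{n even}; 26763 is split because a
   numeral of that size overflows the stack (numerals are unary here). *)
Definition maxAZI (n : nat) : rat :=
  4456 / 125 * n%:R - (26 * 1000 + 763) / 2000 - 2312 / 3375 * (~~ odd n)%:R.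

(* Main.v *)
(* The level x - y of a square grows by one along a chain, and a corner only meets
   squares of neighbouring levels.  Hence prepending a square changes AZI by an
   amount that depends only on the first four squares, and AZI is an affine
   function of n minus a cost charged to the links between consecutive squares.
   The links of one segment cost nothing in total exactly if the segment has
   length 3, and otherwise at least as much as an internal segment of length 2.
   Since the lengths minus one add up to n - 1, not all segments have length 3 if
   n is even, and the cheapest defect is a single internal segment of length 2. *)
From HB Require Import structures.
Require Import Defs.
From mathcomp Require Import zify ring lra.

Set Implicit Arguments.
Unset Strict Implicit.
Unset Printing Implicit Defensive.

Import Order.TTheory GRing.Theory Num.Theory.

Section ChainGraph.

Local Open Scope ring_scope.

Definition incident (u : point) : pred (point * point) :=
  [pred e | (e.1 == u) || (e.2 == u)].

Definition meets (c : chain) : pred (point * point) :=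
  [pred e | has (incident e.1) (edges c) || has (incident e.2) (edges c)].

Lemma mem_edges (c : chain) (e : point * point) :
  reflect (exists2 s : point, s \in c & e \in sides s) (e \in edges c).
Proof. by rewrite mem_undup; apply: flatten_mapP. Qed.

Lemma mem_edges_cat (a b : chain) (e : point * point) :
  (e \in edges (a ++ b)) = (e \in edges a) || (e \in edges b).
Proof. by rewrite !mem_undup map_cat flatten_cat mem_cat. Qed.

Lemma edges_uniq (c : chain) : uniq (edges c).
Proof. exact: undup_uniq. Qed.

Lemma perm_edges_catC (a b : chain) :
  perm_eq (edges (a ++ b)) (edges (b ++ a)).
Proof.
apply: uniq_perm; rewrite ?edges_uniq // => e.
by rewrite !mem_edges_cat orbC.
Qed.

Lemma deg_catC (a b : chain) : deg (a ++ b) =1 deg (b ++ a).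
Proof. by move=> u; apply/permP/perm_edges_catC. Qed.

Lemma deg_catl (a b : chain) (u : point) :
  ~~ has (incident u) (edges b) -> deg (a ++ b) u = deg a u.
Proof.
move=> /hasPn not_b; rewrite /deg -/(incident u) -!size_filter.
apply/perm_size/uniq_perm; rewrite ?filter_uniq ?edges_uniq // => e.
rewrite !mem_filter mem_edges_cat andb_orr orbC.
by case: (boolP (e \in edges b)) => [/not_b/negPf-> // | _]; rewrite andbF.
Qed.

Lemma meets_edge (c : chain) (e : point * point) : e \in edges c -> meets c e.
Proof. by move=> ec; apply/orP; left; apply/hasP; exists e; last exact: predU1l. Qed.

Definition translate (v p : point) : point := (p.1 + v.1, p.2 + v.2).

Definition translate_edge (v : point) (e : point * point) : point * point :=
  (translate v e.1, translate v e.2).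

Lemma translate_inj (v : point) : injective (translate v).
Proof. by move=> [x y] [x' y'] [/addIr-> /addIr->]. Qed.

Lemma translate_edge_inj (v : point) : injective (translate_edge v).
Proof.
by move=> [[? ?] [? ?]] [[? ?] [? ?]] [/addIr-> /addIr-> /addIr-> /addIr->].
Qed.

Lemma edges_translate (v : point) (c : chain) :
  edges (map (translate v) c) = map (translate_edge v) (edges c).
Proof.
rewrite /edges -(undup_map_inj (@translate_edge_inj v)) map_flatten -!map_comp.
congr (undup (flatten _)); apply: eq_map => -[x y] /=.
by rewrite /translate_edge /translate /= !(addrAC _ 1).
Qed.

Lemma deg_translate (v : point) (c : chain) (u : point) :
  deg (map (translate v) c) (translate v u) = deg c u.
Proof.
rewrite /deg edges_translate count_map; apply: eq_count => e /=.
by rewrite !(inj_eq (@translate_inj v)).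
Qed.

End ChainGraph.

Section BondIncidentDegreeIndex.

Local Open Scope ring_scope.

Variables (V : nmodType) (w : nat -> nat -> V).

Definition bid_index (c : chain) : V :=
  \sum_(e <- edges c) w (deg c e.1) (deg c e.2).

Definition bid_index_on (P : pred (point * point)) (c : chain) : V :=
  \sum_(e <- edges c | P e) w (deg c e.1) (deg c e.2).

Lemma bid_indexID (P : pred (point * point)) (c : chain) :
  bid_index c = bid_index_on P c + bid_index_on (predC P) c.
Proof. exact: bigID. Qed.

Lemma bid_index_on_catl (P : pred (point * point)) (a b : chain) :
  (forall e, e \in edges (a ++ b) -> P e -> ~~ meets b e) ->
  bid_index_on P (a ++ b) = bid_index_on P a.
Proof.
move=> P_avoids_b; rewrite /bid_index_on -[LHS]big_filter -[RHS]big_filter.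
have P_edges : perm_eq [seq e <- edges (a ++ b) | P e] [seq e <- edges a | P e].
  apply: uniq_perm; rewrite ?filter_uniq ?edges_uniq // => e; rewrite !mem_filter.
  have := P_avoids_b e; rewrite mem_edges_cat; case: (P e) => //= avoids.
  case: (boolP (e \in edges b)) => [eb | _]; last by rewrite orbF.
  by have := avoids _ isT; rewrite eb orbT meets_edge // => /(_ isT).
rewrite (perm_big _ P_edges); apply: eq_big_seq => e.
rewrite mem_filter => /andP[Pe ea].
have /norP[b1 b2] : ~~ meets b e by apply: P_avoids_b; rewrite ?mem_edges_cat ?ea.
by rewrite !deg_catl.
Qed.

Lemma bid_index_on_catC (P : pred (point * point)) (a b : chain) :
  bid_index_on P (a ++ b) = bid_index_on P (b ++ a).
Proof.
rewrite /bid_index_on (perm_big _ (perm_edges_catC a b)).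
by apply: eq_bigr => e _; rewrite !(deg_catC a b).
Qed.

(* Cut the edges according to whether they meet [a]: those that do ignore [c],
   the others ignore [a]. *)
Lemma bid_index_modular (a b c : chain) :
  (forall e, e \in edges (a ++ b ++ c) -> meets a e -> ~~ meets c e) ->
  bid_index (a ++ b ++ c) + bid_index b = bid_index (a ++ b) + bid_index (b ++ c).
Proof.
move=> separated.
have away_from_a d : bid_index_on (predC (meets a)) (a ++ d)
    = bid_index_on (predC (meets a)) d.
  by rewrite bid_index_on_catC bid_index_on_catl.
have near_a : bid_index_on (meets a) (a ++ b ++ c) = bid_index_on (meets a) (a ++ b).
  by rewrite catA bid_index_on_catl // -catA.
have near_a_in_b : bid_index_on (meets a) (b ++ c) = bid_index_on (meets a) b.
  apply: bid_index_on_catl => e bc_e.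
  by apply: separated; rewrite mem_edges_cat bc_e orbT.
rewrite !(bid_indexID (meets a)) !away_from_a near_a near_a_in_b.
by rewrite addrACA [RHS]addrACA; congr (_ + _); exact: addrC.
Qed.

Lemma bid_index_translate (v : point) (c : chain) :
  bid_index (map (translate v) c) = bid_index c.
Proof.
rewrite /bid_index edges_translate big_map.
by apply: eq_bigr => e _; rewrite !deg_translate.
Qed.

End BondIncidentDegreeIndex.

Section Scanl.

Variables (T1 T2 : Type) (f : T1 -> T2 -> T1).

Lemma take_scanl (x : T1) (s : seq T2) (n : nat) :
  take n (scanl f x s) = scanl f x (take n s).
Proof. by elim: s x n => [|y s IH] x [|n] //=; rewrite IH. Qed.

Lemma drop_cons_scanl (x : T1) (s : seq T2) (n : nat) : n <= size s ->
  drop n (x :: scanl f x s)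
  = foldl f x (take n s) :: scanl f (foldl f x (take n s)) (drop n s).
Proof. by elim: s x n => [|z s IH] x [|n] //= le_ns; apply: IH. Qed.

End Scanl.

Section Walks.

Local Open Scope ring_scope.

Definition step (d : bool) : point := if d then down else right.

Definition advance (p : point) (d : bool) : point := translate (step d) p.

Definition walk (p : point) (ds : seq bool) : chain := p :: scanl advance p ds.

(* [t] lists the turns: its item of index i is [true] iff the chain changes
   direction at its square of index i + 1. *)
Definition turn_chain (t : seq bool) : chain :=
  walk (0, 0) (false :: scanl addb false t).

Lemma size_turn_chain (t : seq bool) : size (turn_chain t) = (size t).+2.
Proof. by rewrite /= !size_scanl. Qed.

Lemma squares_from_walk (s : point) (x : bool) (L : seq nat) :
  squares_from s (step x) L = walk s (scanl addb x [seq l != 1%N | l <- L]).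
Proof.
elim: L s x => //= l L IH s x.
have -> : (if l == 1%N then step x else other_dir (step x))
    = step (x (+) (l != 1%N)).
  by case: (l == 1%N); case: x.
by rewrite IH.
Qed.

Lemma polyomino_chainP (n : nat) (c : chain) :
  polyomino_chain n c <-> exists2 t : seq bool, (size t).+2 = n & c = turn_chain t.
Proof.
have PC_turns L : PC L = turn_chain [seq l != 1%N | l <- L].
  by rewrite /PC -[right]/(step false) squares_from_walk.
split=> [[L /andP[/eqP <- _] ->] | [t <- ->]].
  by exists [seq l != 1%N | l <- L]; rewrite ?size_map.
exists [seq if a then 2 else 1%N | a <- t].
  by rewrite /link_vector size_map eqxx; apply/allP => _ /mapP[[] _ ->].
by rewrite PC_turns -map_comp map_id_in // => -[].
Qed.

Lemma walk_translate (v p : point) (ds : seq bool) :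
  walk (translate v p) ds = map (translate v) (walk p ds).
Proof.
rewrite /walk /=; congr (_ :: _); elim: ds p => //= d ds IH p.
have -> : advance (translate v p) d = translate v (advance p d).
  by rewrite /advance /translate /= !(addrAC _ v.1) !(addrAC _ v.2).
by rewrite IH.
Qed.

Lemma bid_index_walk (V : nmodType) (w : nat -> nat -> V) (p : point) (ds : seq bool) :
  bid_index w (walk p ds) = bid_index w (walk (0, 0) ds).
Proof.
rewrite -(bid_index_translate w p (walk (0, 0) ds)) -walk_translate.
by rewrite /translate !add0r; case: p.
Qed.

Definition level (p : point) : int := p.1 - p.2.

Lemma level_advance (p : point) (d : bool) : level (advance p d) = level p + 1.
Proof. by case: p d => x y []; rewrite /level /=; lia. Qed.

Lemma level_scanl_advance (p s : point) (ds : seq bool) :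
  s \in scanl advance p ds -> level p + 1 <= level s.
Proof.
elim: ds p => //= d ds IH p; rewrite inE.
by case/predU1P => [-> | /IH]; rewrite level_advance; lia.
Qed.

Lemma level_sides (s : point) (e : point * point) : e \in sides s ->
  [/\ level s - 1 <= level e.1 <= level s + 1,
      level s - 1 <= level e.2 <= level s + 1
    & level e.1 - 1 <= level e.2 <= level e.1 + 1].
Proof.
case: s => x y; rewrite !inE /level => /or4P[] /eqP-> /=;
by split; apply/andP; split; lia.
Qed.

Lemma level_incident (c : chain) (u : point) : has (incident u) (edges c) ->
  exists2 s : point, s \in c & level s - 1 <= level u <= level s + 1.
Proof.
case/hasP => e /mem_edges[s cs /level_sides[lvl1 lvl2 _]].
by case/orP => /eqP<-; exists s.
Qed.

Lemma level_meets (c : chain) (e : point * point) : meets c e ->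
  exists2 s : point, s \in c & level s - 1 <= level e.1 <= level s + 1
                            \/ level s - 1 <= level e.2 <= level s + 1.
Proof. by case/orP => /level_incident[s cs lvl]; exists s; [| left | | right]. Qed.

Lemma far_level_not_meets (a c d : chain) :
  (forall s s', s \in a -> s' \in c -> level s + 4 <= level s') ->
  forall e, e \in edges d -> meets a e -> ~~ meets c e.
Proof.
move=> far e /mem_edges[_ _ /level_sides[_ _ lvl]] /level_meets[s a_s lvl_a].
by apply/negP => /level_meets[s' c_s' lvl_c]; have := far _ _ a_s c_s'; lia.
Qed.

Lemma bid_index_walk_modular (V : nmodType) (w : nat -> nat -> V)
    (p : point) (x y z : bool) (ds : seq bool) :
  let q := advance p x in
  bid_index w (walk p [:: x, y, z & ds]) + bid_index w (walk q [:: y; z]) =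
    bid_index w (walk p [:: x; y; z]) + bid_index w (walk q [:: y, z & ds]).
Proof.
pose far_end := scanl advance (advance (advance (advance p x) y) z) ds.
apply: (@bid_index_modular V w [:: p] (walk (advance p x) [:: y; z]) far_end).
apply: far_level_not_meets => s s'; rewrite inE => /eqP-> /level_scanl_advance.
by rewrite !level_advance; lia.
Qed.

End Walks.

HB.lock Definition AZI_weight (i j : nat) : rat :=
  (((i%:R * j%:R) / (i%:R + j%:R - 2)) ^+ 3)%R.

(* The affine bound and the three costs are the only values for which
   [AZI_walk_small] holds: the chains with three and four squares determine them.
   Like [AZI_weight], they are locked because unification would evaluate them in
   unary. *)
HB.lock Definition AZI_bound (n : nat) : rat :=
  (4456 / 125 * n%:R - (26 * 1000 + 763) / 2000)%R.

HB.lock Definition short_internal_cost : rat := (2312 / 3375)%R.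

HB.lock Definition short_external_cost : rat := (3829 / 4000)%R.

HB.lock Definition extra_square_cost : rat := (11809 / 8000)%R.

Section ClosedForm.

Local Open Scope ring_scope.

Lemma AZI_bid_index (c : chain) : AZI c = bid_index AZI_weight c.
Proof. by rewrite AZI_weight.unlock. Qed.

Lemma AZI_weightC (i j : nat) : AZI_weight i j = AZI_weight j i.
Proof. by rewrite AZI_weight.unlock [i%:R * _]mulrC [i%:R + _]addrC. Qed.

Lemma AZI_weight2S (j : nat) : AZI_weight 2 j.+1 = 8.
Proof.
have j_neq0 : j.+1%:R != 0 :> rat by rewrite pnatr_eq0.
by rewrite AZI_weight.unlock [2 + _]addrC addrK mulfK //; ring.
Qed.

Lemma AZI_weight33 : AZI_weight 3 3 = 729 / 64.
Proof. by rewrite AZI_weight.unlock; field. Qed.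

Lemma AZI_weight34 : AZI_weight 3 4 = 1728 / 125.
Proof. by rewrite AZI_weight.unlock; field. Qed.

Lemma AZI_weight44 : AZI_weight 4 4 = 512 / 27.
Proof. by rewrite AZI_weight.unlock; field. Qed.

Definition degree_pairs (c : chain) : seq (nat * nat) :=
  [seq (deg c e.1, deg c e.2) | e <- edges c].

Lemma AZI_degree_pairs (c : chain) :
  AZI c = \sum_(q <- degree_pairs c) AZI_weight q.1 q.2.
Proof. by rewrite big_map AZI_bid_index. Qed.

Lemma AZI_boundS (n : nat) : AZI_bound n.+1 = AZI_bound n + 4456 / 125.
Proof. by rewrite AZI_bound.unlock -natr1; field. Qed.

(* The first and the last square, of indices 0 and [(size t).+1], count as kinks. *)
Definition kink (t : seq bool) (j : nat) : bool := nth true (true :: t) j.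

(* The link j joins the squares of indices j and j + 1: it is a whole segment of
   length 2 if both are kinks, and an inner link of a longer one if neither is. *)
Definition link_cost (t : seq bool) (j : nat) : rat :=
  if kink t j (+) kink t j.+1 then 0
  else if ~~ kink t j then extra_square_cost
  else if (j == 0%N) || (j == size t) then short_external_cost
  else short_internal_cost.

Definition turn_cost (t : seq bool) : rat :=
  \sum_(0 <= j < (size t).+1) link_cost t j.

Lemma turn_cost_cons2 (a b : bool) (t : seq bool) :
  turn_cost [:: a, b & t] =
    link_cost [:: a; b] 0 + link_cost [:: a; b] 1 - link_cost [:: b] 0
      + turn_cost (b :: t).
Proof.
rewrite /turn_cost [LHS]big_nat_recl // big_nat_recl // [in RHS]big_nat_recl //.
rewrite !addrA; congr (_ + _).
by rewrite -[link_cost (b :: t) 0]/(link_cost [:: b] 0) subrK.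
Qed.

Lemma turn_cost_modular (a b : bool) (t : seq bool) :
  turn_cost [:: a, b & t] + turn_cost [:: b]
  = turn_cost [:: a; b] + turn_cost (b :: t).
Proof. by rewrite !(turn_cost_cons2 a b) addrAC. Qed.

Lemma AZI_walk_small (p : point) (x : bool) (t : seq bool) :
  (0 < size t <= 2)%N ->
  AZI (walk p (x :: scanl addb x t)) = AZI_bound (size t).+2 - turn_cost t.
Proof.
rewrite AZI_bid_index bid_index_walk -AZI_bid_index AZI_degree_pairs.
rewrite /turn_cost !big_nat_recl //.
case: t => [|a [|b [|]]] //= _; case: x; case: a; try case: b.
all: set pairs := degree_pairs _; vm_compute in pairs; rewrite {}/pairs.
all: rewrite !big_cons !big_nil /= ?(AZI_weight2S, fun j => AZI_weightC j.+3 2,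
       AZI_weight33, AZI_weight34, AZI_weightC 4 3, AZI_weight44).
all: rewrite /link_cost /kink /=.
all: rewrite AZI_bound.unlock ?short_internal_cost.unlock.
all: by rewrite ?short_external_cost.unlock ?extra_square_cost.unlock; field.
Qed.

Lemma AZI_walk (p : point) (x : bool) (t : seq bool) : (0 < size t)%N ->
  AZI (walk p (x :: scanl addb x t)) = AZI_bound (size t).+2 - turn_cost t.
Proof.
elim: t p x => [// | a [_ | b t IH]] p x _; first exact: AZI_walk_small.
set y := x (+) a; pose q := advance p x.
have : AZI (walk p (x :: scanl addb x [:: a, b & t]))
      + AZI (walk q (y :: scanl addb y [:: b]))
    = AZI (walk p (x :: scanl addb x [:: a; b]))
      + AZI (walk q (y :: scanl addb y (b :: t))).
  by rewrite !AZI_bid_index; apply: bid_index_walk_modular.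
rewrite IH // (@AZI_walk_small q y [:: b]) // (@AZI_walk_small p x [:: a; b]) //=.
rewrite !AZI_boundS.
by have := turn_cost_modular a b t; lra.
Qed.

Lemma AZI_turn_chain (t : seq bool) : (0 < size t)%N ->
  AZI (turn_chain t) = AZI_bound (size t).+2 - turn_cost t.
Proof. exact: AZI_walk. Qed.

End ClosedForm.

Section Segments.

Lemma constant_fst_walk (p : point) (ds : seq bool) :
  constant [seq s.1 | s <- walk p ds] = all id ds.
Proof.
elim: ds p => //= -[] ds IH p /=; first by rewrite -(IH (advance p true)) /= addr0 eqxx.
by case: eqP => //; lia.
Qed.

Lemma constant_snd_walk (p : point) (ds : seq bool) :
  constant [seq s.2 | s <- walk p ds] = all negb ds.
Proof.
elim: ds p => //= -[] ds IH p /=; last by rewrite -(IH (advance p false)) /= addr0 eqxx.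
by case: eqP => //; lia.
Qed.

Lemma all_scanl_addb (x : bool) (t : seq bool) : let ds := x :: scanl addb x t in
  all id ds || all negb ds = all negb t.
Proof.
elim: t x => [|a t IH] x /=; first by case: x.
by rewrite -(IH (x (+) a)) /=; case: x; case: a; rewrite //= ?andbF.
Qed.

Lemma squares_of_turn_chain (t : seq bool) (a b : nat) : a <= b <= size t ->
  exists q x, squares_of (turn_chain t) (a, b.+1)
              = walk q (x :: scanl addb x (drop a (take b t))).
Proof.
case/andP => le_ab le_bt; rewrite /squares_of.
have -> : take b.+2 (turn_chain t)
    = walk (0%R, 0%R) (false :: scanl addb false (take b t)).
  by rewrite /= !take_scanl.
have size_bt : size (take b t) = b by rewrite size_takel.
by do 2 eexists; rewrite /walk !drop_cons_scanl //= ?size_scanl size_bt // leqW.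
Qed.

Lemma aligned_turn_chain (t : seq bool) (a b : nat) :
  aligned_run (turn_chain t) (a, b)
  = [&& a < b, b <= (size t).+1 & all negb (drop a (take b.-1 t))].
Proof.
rewrite /aligned_run size_turn_chain ltnS [(a, b).1]/= [(a, b).2]/=.
case: b => [|b]; first by rewrite ltn0.
rewrite !ltnS; case: (leqP a b) => // le_ab; case: (leqP b) => // le_bt; rewrite !andTb.
have [|q [x ->]] := @squares_of_turn_chain t a b; first by rewrite le_ab.
by rewrite constant_fst_walk constant_snd_walk all_scanl_addb.
Qed.

Lemma alignedP (t : seq bool) (r : nat * nat) :
  reflect [/\ r.1 < r.2, r.2 <= (size t).+1 & forall j, r.1 < j < r.2 -> ~~ kink t j]
    (aligned_run (turn_chain t) r).
Proof.
case: r => a b; rewrite aligned_turn_chain.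
apply: (iffP and3P) => -[/= lt_ab le_bt straight]; split=> //.
  case=> [//|j] /andP[lt_aj lt_jb].
  have lt_j : j - a < size (drop a (take b.-1 t)) by rewrite size_drop size_takel; lia.
  have := all_nthP true straight _ lt_j.
  by rewrite nth_drop nth_take subnKC //; lia.
apply/(all_nthP true) => i; rewrite size_drop size_takel => [lt_i|]; last lia.
rewrite nth_drop nth_take; last lia.
by apply: (straight (a + i).+1); lia.
Qed.

Lemma mem_runs (c : chain) (r : nat * nat) : (r \in runs c) = aligned_run c r.
Proof.
rewrite mem_filter; apply: andb_idr; case: r => a b /and3P[/= lt_ab lt_bc _].
by apply/allpairsP; exists (a, b); rewrite !mem_iota /=; split=> //; lia.
Qed.

Lemma segments_uniq (c : chain) : uniq (segments c).
Proof.
rewrite !filter_uniq //; apply: allpairs_uniq; rewrite ?iota_uniq //.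
by move=> [? ?] [? ?].
Qed.

Lemma segmentsP (t : seq bool) (r : nat * nat) :
  reflect [/\ r.1 < r.2, r.2 <= (size t).+1, kink t r.1, kink t r.2
            & forall j, r.1 < j < r.2 -> ~~ kink t j]
    (r \in segments (turn_chain t)).
Proof.
case: r => a b; rewrite mem_filter mem_runs.
apply: (iffP andP) => /= [[/allP maximal /alignedP/=[lt_ab le_bt straight]] | ].
  have not_larger u v : u <= a -> b <= v -> v <= (size t).+1 ->
      (forall j, u < j < v -> ~~ kink t j) -> u = a /\ v = b.
    move=> le_ua le_bv le_vt straight_uv.
    have := maximal (u, v); rewrite mem_runs /= le_ua le_bv => larger.
    by have /eqP[] : (u, v) == (a, b) by apply/larger/alignedP; split=> //=; lia.
  split=> //; apply/negPn/negP => no_kink.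
    have [] : a.-1 = a /\ b = b.
      apply: not_larger => //; first by lia.
      move=> j; case: (eqVneq j a) => [-> // | ne_ja] ?.
      by apply: straight; lia.
    by case: (a) no_kink => //; lia.
  have ne_bt : b <> (size t).+1.
    by move=> eq_bt; move: no_kink; rewrite /kink nth_default ?eq_bt.
  have [] : a = a /\ b.+1 = b; last lia.
  apply: not_larger => //; first by lia.
  move=> j; case: (eqVneq j b) => [-> // | ne_jb] ?.
  by apply: straight; lia.
case=> lt_ab le_bt kink_a kink_b straight; split; last exact/alignedP.
apply/allP => -[u v]; rewrite mem_runs => /alignedP[/= lt_uv le_vt straight_uv].
apply/implyP => /andP[le_ua le_bv]; apply/eqP; congr (_, _).
  apply/eqP; rewrite eqn_leq le_ua leqNgt; apply: contraL kink_a => lt_ua.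
  by apply: straight_uv; lia.
apply/eqP; rewrite eqn_leq le_bv andbT leqNgt; apply: contraL kink_b => lt_bv.
by apply: straight_uv; lia.
Qed.

Lemma segment_of_link (t : seq bool) (j : nat) : j <= size t ->
  exists2 r : nat * nat, r \in segments (turn_chain t) & r.1 <= j < r.2.
Proof.
move=> le_jt.
have kink_before : exists a, (a <= j) && kink t a by exists 0.
have kink_before_le a : (a <= j) && kink t a -> a <= j by case/andP.
have [a /andP[le_aj kink_a] last_kink] := ex_maxnP kink_before kink_before_le.
have kink_after : exists b, (j < b) && kink t b.
  by exists (size t).+1; rewrite ltnS le_jt /kink nth_default.
have [b /andP[lt_jb kink_b] first_kink] := ex_minnP kink_after.
exists (a, b); last by rewrite /= le_aj.
apply/segmentsP; split=> //=; first by lia.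
  by apply: first_kink; rewrite ltnS le_jt /kink nth_default.
move=> i /andP[lt_ai lt_ib]; apply/negP => kink_i.
case: (leqP i j) => [le_ij | lt_ji].
  by have := last_kink i; rewrite le_ij kink_i; lia.
by have := first_kink i; rewrite lt_ji kink_i; lia.
Qed.

Lemma segments_disjoint (t : seq bool) (r r' : nat * nat) (j : nat) :
  r \in segments (turn_chain t) -> r' \in segments (turn_chain t) ->
  r.1 <= j < r.2 -> r'.1 <= j < r'.2 -> r = r'.
Proof.
case: r r' => [a b] [a' b'] /segmentsP[/= _ _ kink_a kink_b straight].
case/segmentsP => /= _ _ kink_a' kink_b' straight' r_j r'_j.
have no_kink_in := fun u => contraL (straight u).
have no_kink_in' := fun u => contraL (straight' u).
congr (_, _).
  have := no_kink_in a' kink_a'; have := no_kink_in' a kink_a; lia.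
have := no_kink_in b' kink_b'; have := no_kink_in' b kink_b; lia.
Qed.

Lemma big_segments (R : Type) (idx : R) (op : Monoid.com_law idx)
    (t : seq bool) (F : nat -> R) :
  \big[op/idx]_(r <- segments (turn_chain t)) \big[op/idx]_(r.1 <= j < r.2) F j
  = \big[op/idx]_(0 <= j < (size t).+1) F j.
Proof.
transitivity (\big[op/idx]_(r <- segments (turn_chain t))
    \big[op/idx]_(0 <= j < (size t).+1 | r.1 <= j < r.2) F j).
  apply: eq_big_seq => r /segmentsP[_ le_rt _ _ _].
  rewrite (big_nat_widen _ _ _ _ _ le_rt) (big_nat_widenl _ 0) //.
  by apply: eq_bigl => j; rewrite andbC.
rewrite (exchange_big_dep predT) //=; apply: eq_big_nat => j /andP[_ lt_jt].
have [r seg_r r_j] := segment_of_link lt_jt.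
rewrite -big_filter (@eq_in_filter _ _ (pred1 r)) => [|r' seg_r'].
  by rewrite filter_pred1_uniq ?segments_uniq // big_seq1.
by apply/idP/eqP => [r'_j | -> //]; exact: segments_disjoint seg_r' seg_r r'_j r_j.
Qed.

End Segments.

Section SegmentCosts.

Local Open Scope ring_scope.

Lemma short_internal_cost_least :
  [/\ 0 < short_internal_cost, short_internal_cost < short_external_cost
    & short_internal_cost < extra_square_cost].
Proof.
rewrite short_internal_cost.unlock short_external_cost.unlock extra_square_cost.unlock.
by split; lra.
Qed.

Definition segment_cost (c : chain) (r : nat * nat) : rat :=
  if (seg_length r <= 2)%N then
    if external c r then short_external_cost else short_internal_cost
  else extra_square_cost *+ (seg_length r - 3).

Definition chain_cost (c : chain) : rat := \sum_(r <- segments c) segment_cost c r.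

Lemma segment_cost_links (t : seq bool) (r : nat * nat) :
  r \in segments (turn_chain t) ->
  \sum_(r.1 <= j < r.2) link_cost t j = segment_cost (turn_chain t) r.
Proof.
case: r => a [|b] /segmentsP[] //= lt_ab _ kink_a kink_b straight.
rewrite /segment_cost /seg_length /external size_turn_chain /=.
have no_kink j : (a < j <= b)%N -> kink t j = false by move/straight/negbTE.
move: lt_ab; rewrite ltnS leq_eqVlt => /predU1P[eq_ab | lt_ab].
  by rewrite -eq_ab subSnn big_nat1 /link_cost kink_a eq_ab kink_b eqSS.
rewrite ifF; last by lia.
rewrite big_ltn ?leqW // big_nat_recr //=.
rewrite {1}/link_cost kink_a no_kink ?ltnSn // add0r.
rewrite {2}/link_cost kink_b no_kink ?lt_ab ?leqnn // addr0.
rewrite (eq_big_nat _ _ (F2 := fun=> extra_square_cost)) => [|j a_j_b].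
  by rewrite sumr_const_nat; congr (_ *+ _); lia.
by rewrite /link_cost !no_kink //; lia.
Qed.

Lemma chain_cost_turns (t : seq bool) : chain_cost (turn_chain t) = turn_cost t.
Proof.
rewrite /turn_cost -big_segments.
by apply: eq_big_seq => r /segment_cost_links.
Qed.

Lemma AZI_chain_cost (n : nat) (c : chain) : (2 < n)%N -> polyomino_chain n c ->
  AZI c = AZI_bound n - chain_cost c.
Proof.
move=> n_gt2 /polyomino_chainP[t size_t ->].
by rewrite chain_cost_turns AZI_turn_chain ?size_t //; lia.
Qed.

Lemma seg_length_gt1 (c : chain) (r : nat * nat) :
  r \in segments c -> (1 < seg_length r)%N.
Proof.
by rewrite mem_filter mem_runs => /andP[_ /and3P[]]; rewrite /seg_length; lia.
Qed.

Lemma sum_seg_length (n : nat) (c : chain) : polyomino_chain n c ->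
  (\sum_(r <- segments c) (seg_length r).-1)%N = n.-1.
Proof.
case/polyomino_chainP => t <- ->.
have -> : (size t).+2.-1 = (\sum_(0 <= j < (size t).+1) 1)%N.
  by rewrite sum_nat_const_nat subn0 muln1.
rewrite -big_segments; apply: eq_bigr => r _.
by rewrite sum_nat_const_nat muln1.
Qed.

Lemma size_segments (n : nat) (c : chain) (short : pred (nat * nat)) :
  polyomino_chain n c ->
  {in segments c, forall r, seg_length r = if short r then 2%N else 3} ->
  ((size (segments c)).*2 = n.-1 + count short (segments c))%N.
Proof.
move=> /sum_seg_length <- len_c.
rewrite -sum1_count [X in (_ + X)%N]big_mkcond -big_split -muln2 -sum1_size big_distrl.
by apply: eq_big_seq => r /len_c ->; case: (short r).
Qed.

Lemma segment_cost_ge0 (c : chain) (r : nat * nat) : 0 <= segment_cost c r.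
Proof.
have [gt0 lt_ext lt_extra] := short_internal_cost_least; rewrite /segment_cost.
by case: ifP => _; [case: ifP => _ | apply: mulrn_wge0]; lra.
Qed.

Lemma segment_cost_leif (c : chain) (r : nat * nat) :
  (1 < seg_length r)%N -> seg_length r != 3 ->
  short_internal_cost <= segment_cost c r ?= iff internal c r && (seg_length r == 2).
Proof.
have [gt0 lt_ext lt_extra] := short_internal_cost_least.
rewrite /segment_cost /internal; case: (seg_length r) => [|[|[|[|k]]]] // _ _.
  by apply/leifP; rewrite andbT /=; case: (external c r); rewrite //= eqxx.
apply/leifP; rewrite andbF /= !subSS subn0 mulrS ltr_wpDr // mulrn_wge0 //.
by lra.
Qed.

Lemma segment_cost_eq0 (c : chain) (r : nat * nat) :
  (1 < seg_length r)%N -> (segment_cost c r == 0) = (seg_length r == 3).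
Proof.
move=> len_gt1; case: (eqVneq (seg_length r) 3) => [len3 | len_ne3].
  by rewrite /segment_cost len3 eqxx.
have [gt0 _ _] := short_internal_cost_least; apply/gt_eqF/(lt_le_trans gt0).
by rewrite (segment_cost_leif c len_gt1 len_ne3).
Qed.

Lemma chain_cost_eq0 (c : chain) :
  (chain_cost c == 0) = all (fun r => seg_length r == 3) (segments c).
Proof.
rewrite psumr_eq0 => [|r _]; last exact: segment_cost_ge0.
by apply: eq_in_all => r /seg_length_gt1/(segment_cost_eq0 c).
Qed.

Lemma chain_cost_neq0P (c : chain) :
  reflect (exists2 r, r \in segments c & seg_length r != 3) (chain_cost c != 0).
Proof. by rewrite chain_cost_eq0; apply: allPn. Qed.

Lemma chain_cost_leif (c : chain) (r : nat * nat) :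
  r \in segments c -> seg_length r != 3 ->
  short_internal_cost <= chain_cost c ?= iff
    [&& internal c r, seg_length r == 2
      & all (fun r' => (r' != r) ==> (seg_length r' == 3)) (segments c)].
Proof.
move=> c_r len_ne3; have len_gt1 := seg_length_gt1 c_r.
rewrite /chain_cost (bigD1_seq r) ?segments_uniq //= andbA -[short_internal_cost]addr0.
apply: leifD; first exact: segment_cost_leif.
split; first by apply: sumr_ge0 => r' _; exact: segment_cost_ge0.
rewrite eq_sym psumr_eq0 => [|r' _]; last exact: segment_cost_ge0.
by apply: eq_in_all => r' /seg_length_gt1/(segment_cost_eq0 c)->.
Qed.

Lemma chain_cost0_size (n : nat) (c : chain) :
  polyomino_chain n c -> chain_cost c = 0 -> n = (size (segments c)).*2.+1.
Proof.
move=> c_n /eqP; rewrite chain_cost_eq0 => /allP len3.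
have := @size_segments n c pred0 c_n (fun r c_r => eqP (len3 r c_r)).
by have /polyomino_chainP[t <- _] := c_n; rewrite count_pred0; lia.
Qed.

Lemma AZ1P (m : nat) (c : chain) :
  AZ1 m c <-> polyomino_chain m.*2.+1 c /\ chain_cost c = 0.
Proof.
split=> [[[n c_n] <- len3] | [c_m cost0]].
  have cost0 : chain_cost c = 0.
    by apply/eqP; rewrite chain_cost_eq0; apply/allP => r /len3->.
  by rewrite -(chain_cost0_size c_n).
split; [by exists m.*2.+1 | by have := chain_cost0_size c_m cost0; lia |].
by move=> r c_r; move/eqP: cost0; rewrite chain_cost_eq0 => /allP/(_ r c_r)/eqP.
Qed.

Lemma one_short_segment_size (n : nat) (c : chain) (r : nat * nat) :
  polyomino_chain n c -> r \in segments c -> seg_length r = 2 ->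
  (forall r', r' \in segments c -> r' <> r -> seg_length r' = 3) ->
  n = (size (segments c)).*2.
Proof.
move=> c_n c_r len2 len3.
have -> := @size_segments n c (pred1 r) c_n.
  rewrite count_uniq_mem ?segments_uniq // c_r addn1.
  by case/polyomino_chainP: c_n => t <-.
by move=> r' c_r' /=; case: eqP => [-> // | /len3->].
Qed.

Lemma AZ2P (m : nat) (c : chain) :
  AZ2 m c <-> polyomino_chain m.*2 c /\ chain_cost c = short_internal_cost.
Proof.
split=> [[[n c_n] <- [r [c_r int_r len2 len3]]] | [c_m costE]].
  split; first by rewrite -(one_short_segment_size c_n c_r len2 len3).
  apply/esym/eqP; rewrite (chain_cost_leif c_r) ?len2 // int_r.
  by apply/allP => r' c_r'; apply/implyP => /eqP/(len3 r' c_r')->.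
have /chain_cost_neq0P[r c_r len_ne3] : chain_cost c != 0.
  by rewrite costE gt_eqF //; case: short_internal_cost_least.
have := (chain_cost_leif c_r len_ne3).2; rewrite costE eqxx.
case/esym/and3P => int_r /eqP len2 /allP len3.
have {}len3 r' : r' \in segments c -> r' <> r -> seg_length r' = 3.
  by move=> /len3/implyP len3_r' /eqP/len3_r'/eqP.
split; [by exists m.*2 | | by exists r].
by apply: double_inj; rewrite -(one_short_segment_size c_m c_r len2 len3).
Qed.

Definition min_chain_cost (n : nat) : rat := short_internal_cost *+ ~~ odd n.

Lemma min_chain_cost_le (n : nat) (c : chain) :
  polyomino_chain n c -> min_chain_cost n <= chain_cost c.
Proof.
rewrite /min_chain_cost => c_n; case: (boolP (odd n)) => [_ | even_n].
  by apply: sumr_ge0 => r _; exact: segment_cost_ge0.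
have /chain_cost_neq0P[r c_r len_ne3] : chain_cost c != 0.
  apply: contra even_n => /eqP/(chain_cost0_size c_n)->.
  by rewrite /= odd_double.
by rewrite (chain_cost_leif c_r len_ne3).
Qed.

End SegmentCosts.

Section Maximum.

Local Open Scope ring_scope.

Lemma maxAZIE (n : nat) : maxAZI n = AZI_bound n - min_chain_cost n.
Proof.
by rewrite /min_chain_cost -mulr_natr AZI_bound.unlock short_internal_cost.unlock.
Qed.

Definition zigzag (n : nat) : seq bool := traject negb false n.

Lemma size_zigzag (n : nat) : size (zigzag n) = n.
Proof. exact: size_traject. Qed.

Lemma nth_zigzag (x0 : bool) (n i : nat) : (i < n)%N -> nth x0 (zigzag n) i = odd i.
Proof.
by move=> lt_in; rewrite (set_nth_default false) ?size_zigzag // nth_traject.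
Qed.

Lemma link_cost_leif (t : seq bool) (j : nat) :
  0 <= link_cost t j ?= iff kink t j (+) kink t j.+1.
Proof.
have [gt0 lt_ext lt_extra] := short_internal_cost_least; apply/leifP.
rewrite /link_cost; case: (kink t j (+) kink t j.+1) => //.
by do 2?[case: ifP => _]; lra.
Qed.

Lemma turn_cost_eq0 (t : seq bool) : turn_cost t = 0 -> t = zigzag (size t).
Proof.
move/eqP; rewrite psumr_eq0 => [/allP cost0 | j _]; last by rewrite link_cost_leif.
have alternate j : (j <= size t)%N -> kink t j.+1 = ~~ kink t j.
  move=> le_jt; have := cost0 j; rewrite mem_index_iota ltnS le_jt => /(_ isT).
  by rewrite /= eq_sym link_cost_leif; case: (kink t j) => //= /negbTE.
have kink_odd j : (j <= size t)%N -> kink t j.+1 = odd j.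
  by elim: j => [|j IHj] lt_jt; rewrite alternate ?IHj // ltnW.
apply: (@eq_from_nth _ true) => [|j lt_jt]; first by rewrite size_zigzag.
by rewrite nth_zigzag // -kink_odd // ltnW.
Qed.

Lemma zigzag2S (n : nat) : zigzag n.+2 = [:: false, true & zigzag n].
Proof. by []. Qed.

Lemma turn_cost_zigzag (k : nat) : turn_cost (zigzag k.*2.+1) = 0.
Proof.
elim: k => [|k IHk]; first by rewrite /turn_cost unlock /link_cost /= !addr0.
by move: IHk; rewrite doubleS zigzag2S !turn_cost_cons2 /link_cost /=; lra.
Qed.

Lemma turn_cost_double_turn (k : nat) :
  turn_cost [:: false, true, true & zigzag k.*2.+1] = short_internal_cost.
Proof.
have := turn_cost_zigzag k.+1.
by rewrite doubleS zigzag2S !turn_cost_cons2 /link_cost /=; lra.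
Qed.

Lemma min_chain_cost_attained (n : nat) : (5 <= n)%N ->
  exists2 c : chain, polyomino_chain n c & chain_cost c = min_chain_cost n.
Proof.
move=> n_ge5; suff [t size_t cost_t] : exists2 t : seq bool,
    (size t).+2 = n & turn_cost t = min_chain_cost n.
  exists (turn_chain t); last by rewrite chain_cost_turns.
  by apply/polyomino_chainP; exists t.
rewrite /min_chain_cost; case: (boolP (odd n)) => [odd_n | even_n].
  exists (zigzag ((n - 3)./2).*2.+1); last exact: turn_cost_zigzag.
  by rewrite size_zigzag; lia.
exists [:: false, true, true & zigzag ((n - 6)./2).*2.+1].
  by rewrite /= size_traject; lia.
exact: turn_cost_double_turn.
Qed.

Lemma maximizes_AZIP (n : nat) (c : chain) : (5 <= n)%N ->
  maximizes_AZI n c <-> polyomino_chain n c /\ chain_cost c = min_chain_cost n.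
Proof.
move=> n_ge5; have n_gt2 : (2 < n)%N by lia.
have AZI_le c1 c2 : polyomino_chain n c1 -> polyomino_chain n c2 ->
    (AZI c1 <= AZI c2) = (chain_cost c2 <= chain_cost c1).
  by move=> c1_n c2_n; rewrite !(AZI_chain_cost n_gt2) // lerD2l lerN2.
split=> [[c_n max_c] | [c_n cost_c]]; split=> //.
  have [c0 c0_n cost_c0] := min_chain_cost_attained n_ge5.
  by apply: le_anti; rewrite min_chain_cost_le // -cost_c0 -AZI_le // max_c.
by move=> c' c'_n; rewrite AZI_le // cost_c min_chain_cost_le.
Qed.

Lemma AZ1_inj (m : nat) (c c' : chain) : AZ1 m c -> AZ1 m c' -> c = c'.
Proof.
rewrite !AZ1P => -[/polyomino_chainP[t size_t ->] cost_t].
case=> /polyomino_chainP[t' size_t' ->] cost_t'.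
rewrite !chain_cost_turns in cost_t cost_t'.
rewrite (turn_cost_eq0 cost_t) (turn_cost_eq0 cost_t').
by congr (turn_chain (zigzag _)); lia.
Qed.

End Maximum.

Theorem theorem3 (n : nat) (hn : 5 <= n) :
  [/\ odd n ->
        exists c : chain, unique (AZ1 ((n - 1) %/ 2)) c
          /\ forall c' : chain, maximizes_AZI n c' <-> c' = c,
      ~~ odd n ->
        forall c : chain, maximizes_AZI n c <-> AZ2 (n %/ 2) c
    & exists2 c : chain, maximizes_AZI n c & AZI c = maxAZI n].
Proof.
have [c c_n cost_c] := min_chain_cost_attained hn.
have maximizes_cost c' := maximizes_AZIP c' hn.
split=> [odd_n | even_n c' |].
- have n_eq : n = ((n - 1) %/ 2).*2.+1 by lia.
  have maximizes_AZ1 c' : maximizes_AZI n c' <-> AZ1 ((n - 1) %/ 2) c'.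
    by rewrite AZ1P -n_eq maximizes_cost /min_chain_cost odd_n.
  have AZ1_c : AZ1 ((n - 1) %/ 2) c by apply/maximizes_AZ1/maximizes_cost.
  exists c; split; first by split=> // c'; exact: AZ1_inj.
  move=> c'; split=> [/maximizes_AZ1 AZ1_c' | ->]; last exact/maximizes_AZ1.
  exact: AZ1_inj AZ1_c.
- have n_eq : n = (n %/ 2).*2 by lia.
  by rewrite AZ2P -n_eq maximizes_cost /min_chain_cost even_n.
- exists c; first exact/maximizes_cost.
  by rewrite (AZI_chain_cost _ c_n) ?cost_c ?maxAZIE //; lia.
Qed.
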